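(* Let $D$ be an integral domain with quotient field $K$, let $X$ be an indeterminate over $K$, and let $\boldsymbol{\mathcal T}=\{T_\lambda\mid\lambda\in\Lambda\}$ be a family of overrings of $D$. Assume that $\boldsymbol{\mathcal T}$ is nonempty and $\boldsymbol{\mathcal T}\ne\{K\}$. Then: (1) $[\wedge_{\boldsymbol{\mathcal T}}]$, $\langle\wedge_{\boldsymbol{\mathcal T}}\rangle$, and $(\wedge_{\boldsymbol{\mathcal T}})$ (respectively, $[\wedge_{\boldsymbol{\mathcal T}}]$ and $\langle\wedge_{\boldsymbol{\mathcal T}}\rangle$) are distinct extensions (respectively, distinct strict extensions) of $\wedge_{\boldsymbol{\mathcal T}}$. (2) $[\wedge_{\boldsymbol{\mathcal T}}]\sim\langle\wedge_{\boldsymbol{\mathcal T}}\rangle\sim(\wedge_{\boldsymbol{\mathcal T}})$ and, moreover, $[\wedge_{\boldsymbol{\mathcal T}}]\approx\langle\wedge_{\boldsymbol{\mathcal T}}\rangle$, but neither $[\wedge_{\boldsymbol{\mathcal T}}]$ nor $\langle\wedge_{\boldsymbol{\mathcal T}}\rangle$ is strictly equivalent over $D$ to $(\wedge_{\boldsymbol{\mathcal T}})$.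
   Context: For an integral domain $R$ with quotient field $L$, $\overline{\boldsymbol F}(R)$ is the set of nonzero $R$-submodules of $L$; an overring of $R$ is a ring between $R$ and $L$. A semistar operation on $R$ is a map $\star:\overline{\boldsymbol F}(R)\to\overline{\boldsymbol F}(R)$, $E\mapsto E^\star$, such that for all $0\ne x\in L$ and $E,F\in\overline{\boldsymbol F}(R)$: $(xE)^\star=xE^\star$; $E\subseteq F$ implies $E^\star\subseteq F^\star$; $E\subseteq E^\star=(E^\star)^\star$. For a ring $T$, $T(X):=\{f/g\mid f,g\in T[X],\ \boldsymbol c(g)=T\}$ is the Nagata ring of $T$, where $\boldsymbol c(g)$ is the content ideal of $g$ (generated by its coefficients). The semistar operation $\wedge_{\boldsymbol{\mathcal T}}$ on $D$ is $E^{\wedge_{\boldsymbol{\mathcal T}}}:=\bigcap_\lambda ET_\lambda$ for $E\in\overline{\boldsymbol F}(D)$. The following semistar operations on $D[X]$ are defined, for $A\in\overline{\boldsymbol F}(D[X])$, by $$A^{(\wedge_{\boldsymbol{\mathcal T}})}:=\bigcap_\lambda AT_\lambda(X),\qquad A^{\langle\wedge_{\boldsymbol{\mathcal T}}\rangle}:=A^{(\wedge_{\boldsymbol{\mathcal T}})}\cap AK[X],\qquad A^{[\wedge_{\boldsymbol{\mathcal T}}]}:=\bigcap_\lambda AT_\lambda[X].$$ For $E\in\overline{\boldsymbol F}(D)$, $E[X]=E\,D[X]$. A semistar operation $\circledast$ on $D[X]$ is an extension (respectively, a strict extension) of a semistar operation $\star$ on $D$ if $E^\star=(E[X])^\circledast\cap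 K$ (respectively, $E^\star[X]=(E[X])^\circledast$) for all $E\in\overline{\boldsymbol F}(D)$. Two semistar operations $\circledast',\circledast''$ on $D[X]$ are equivalent over $D$, $\circledast'\sim\circledast''$ (respectively, strictly equivalent over $D$, $\circledast'\approx\circledast''$), if $(E[X])^{\circledast'}\cap K=(E[X])^{\circledast''}\cap K$ (respectively, $(E[X])^{\circledast'}=(E[X])^{\circledast''}$) for each $E\in\overline{\boldsymbol F}(D)$. *)

(* Defs.v *)
From mathcomp Require Import all_boot all_order all_algebra.
From mathcomp Require Import boolp classical_sets.

Set Implicit Arguments.
Unset Strict Implicit.
Unset Printing Implicit Defensive.

Import GRing.Theory.

Local Open Scope classical_set_scope.
Local Open Scope ring_scope.

Section Semistar.
(* All rings and modules are subsets of an ambient field L; when semistar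
   operations are considered, R is a subring of L with quotient field L. *)
Variable L : fieldType.
Implicit Types (R M N E F : set L) (star : set L -> set L).

Definition submodule R M : Prop :=
  [/\ M 0, (forall x y, M x -> M y -> M (x + y))
    & forall r x, R r -> M x -> M (r * x)].

Definition Fbar R : set (set L) :=
  [set E | submodule R E /\ E <> [set 0]].

(* The product MN: finite sums of products. *)
Definition mulmod M N : set L :=
  [set x | exists (n : nat) (a b : 'I_n -> L),
     (forall i, M (a i) /\ N (b i)) /\ x = \sum_(i < n) a i * b i].

Definition dilate (x : L) E : set L := [set x * e | e in E].

Definition overring R T : Prop :=
  R `<=` T /\ GRing.subring_closed (mem T).

(* The values of star outside Fbar R are irrelevant. *)
Definition semistar R star : Prop :=
  [/\ forall E, Fbar R E -> Fbar R (star E),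
      forall x E, x != 0 -> Fbar R E -> star (dilate x E) = dilate x (star E),
      forall E F, Fbar R E -> Fbar R F -> E `<=` F -> star E `<=` star F
    & forall E, Fbar R E -> E `<=` star E /\ star E = star (star E)].

Definition same_semistar R star1 star2 : Prop := {in Fbar R, star1 =1 star2}.

End Semistar.

(* D as a subring of its quotient field. *)
Definition range_frac (D : idomainType) : set {fraction D} :=
  range (@tofrac D).

Arguments range_frac D : clear implicits.

Section PolynomialExtensions.
Variable K : fieldType.
Implicit Types (D E S T : set K).

Definition ratfun : fieldType := {fraction {poly K}}.

Implicit Types (A : set ratfun) (circ : set ratfun -> set ratfun).

(* The embedding of K in K(X). *)
Definition cst (c : K) : ratfun := tofrac c%:P.

(* S[X] inside K(X), for a subring S of K. *)
Definition polyring S : set ratfun :=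
  [set tofrac p | p in [set p : {poly K} | forall i, S p`_i]].

(* The ideal of T generated by the coefficients of g, for g in T[X]. *)
Definition content T (g : {poly K}) : set K :=
  smallest (submodule T) [set c | c \in (g : seq K)].

(* T(X) *)
Definition nagata T : set ratfun :=
  [set x | exists f g : {poly K},
     [/\ forall i, T f`_i, forall i, T g`_i, content T g = T
       & x = tofrac f / tofrac g]].

(* E[X] = E D[X] *)
Definition extend D E : set ratfun := mulmod (cst @` E) (polyring D).

(* A `&` K *)
Definition contract A : set K := cst @^-1` A.

Definition is_extension D (star : set K -> set K) circ : Prop :=
  [/\ semistar D star, semistar (polyring D) circ
    & forall E, Fbar D E -> star E = contract (circ (extend D E))].

Definition is_strict_extension D (star : set K -> set K) circ : Prop :=
  [/\ semistar D star, semistar (polyring D) circ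
    & forall E, Fbar D E -> extend D (star E) = circ (extend D E)].

Definition equiv_over D circ1 circ2 : Prop :=
  forall E, Fbar D E ->
    contract (circ1 (extend D E)) = contract (circ2 (extend D E)).

Definition strict_equiv_over D circ1 circ2 : Prop :=
  forall E, Fbar D E -> circ1 (extend D E) = circ2 (extend D E).

Variables (I : Type) (T : I -> set K).

Definition wedge (E : set K) : set K :=
  \bigcap_(i in [set: I]) mulmod E (T i).

(* The operation written with parentheses: A |-> \bigcap_i A T_i(X). *)
Definition wedge_paren A : set ratfun :=
  \bigcap_(i in [set: I]) mulmod A (nagata (T i)).

(* The operation written with angle brackets. *)
Definition wedge_angle A : set ratfun :=
  wedge_paren A `&` mulmod A (polyring [set: K]).

(* The operation written with square brackets: A |-> \bigcap_i A T_i[X]. *)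
Definition wedge_square A : set ratfun :=
  \bigcap_(i in [set: I]) mulmod A (polyring (T i)).

End PolynomialExtensions.

(* Main.v *)
(** If [c(g) = T] and [fg] has all its coefficients in a [T]-module [M], then
    so has [f]. Hence the polynomials [g] with [c(g) = T] are closed under
    products, [T(X)] is a ring, and [E T(X)] meets [K[X]] in [(ET)[X]]. All
    the operations are intersections of extensions to overrings (the angle one
    adds [K[X]] to the family of the [T_i(X)]), so they are semistar; on [E[X]]
    the square and angle ones give [E^star[X]], and the paren one has the same
    constants.

    Since [1/X] belongs to every [T_i(X)], the paren operation differs from
    the other two on [D[X]]. If [T_i] is not [K], it omits the inverse of some
    nonzero [a] in [D]; for the ideal [(a, X)], the angle closure contains [1],
    as [X] is a unit of every [T_j(X)] and [a] is a unit of [K], whereas the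
    square closure does not, as [(a, X) T_i[X]] is proper. *)

Require Import Defs.
From mathcomp Require Import all_boot all_order all_algebra.
From mathcomp Require Import boolp classical_sets.

Set Implicit Arguments.
Unset Strict Implicit.
Unset Printing Implicit Defensive.

Import GRing.Theory.

Local Open Scope classical_set_scope.
Local Open Scope ring_scope.

(** * Submodules of a field, their products, and semistar operations given by overrings *)

Section Modules.
Variable L : fieldType.
Implicit Types (R M N E F P T : set L).

(** Phrased through [submodule], so that every lemma on modules also applies to the ring itself;
    [-1] provides opposites. *)
Definition subring T : Prop := [/\ T 1, T (-1) & submodule T T].

Lemma subringP T : GRing.subring_closed (mem T) <-> subring T.
Proof.
split=> [[T1 TB TM]|[T1 TN1 [T0 TD TM]]].
  have memB x y : T x -> T y -> T (x - y).
    by move=> Tx Ty; apply/set_mem/TB; apply: mem_set.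
  have T0 : T 0 by rewrite -(subrr 1); apply: memB; apply: set_mem.
  have TN x : T x -> T (- x) by move=> Tx; rewrite -sub0r; apply: memB.
  split; [exact: set_mem|by apply/TN/set_mem|split=> // x y Tx Ty].
    by rewrite -[y]opprK; apply/memB/TN.
  by apply/set_mem/TM; apply: mem_set.
split=> [|x y /set_mem Tx /set_mem Ty|x y /set_mem Tx /set_mem Ty];
  apply: mem_set => //; last exact: TM.
by apply: TD => //; rewrite -mulN1r; apply: TM.
Qed.

Lemma submodule_sum R M (J : Type) (r : seq J) (p : pred J) (F : J -> L) :
  submodule R M -> (forall i, p i -> M (F i)) ->
  M (\sum_(i <- r | p i) F i).
Proof. by case=> M0 MD _ MF; apply: big_ind. Qed.

Lemma submoduleN R M x : R (-1) -> submodule R M -> M x -> M (- x).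
Proof. by move=> RN1 [_ _ MZ] Mx; rewrite -mulN1r; apply: MZ. Qed.

Lemma submoduleB R M x y :
  R (-1) -> submodule R M -> M x -> M y -> M (x - y).
Proof.
move=> RN1 modM Mx My; case: (modM) => _ MD _.
by apply/MD => //; apply: submoduleN modM My.
Qed.

Lemma submodule_bigcap R (J : Type) (Q : set J) (M : J -> set L) :
  (forall j, Q j -> submodule R (M j)) -> submodule R (\bigcap_(j in Q) M j).
Proof.
move=> modM; split=> [j Qj|x y Mx My j Qj|r x Rr Mx j Qj];
  have [M0 MD MZ] := modM j Qj; first exact: M0.
- by apply: MD; [apply: Mx|apply: My].
- by apply: MZ => //; apply: Mx.
Qed.

Lemma mulmod_min M N P : P 0 -> (forall x y, P x -> P y -> P (x + y)) ->
  (forall a b, M a -> N b -> P (a * b)) -> mulmod M N `<=` P.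
Proof.
move=> P0 PD PM _ [n [a [b [Mab ->]]]].
by apply: big_ind => // i _; have [] := Mab i; apply: PM.
Qed.

Lemma mem_mulmod M N a b : M a -> N b -> mulmod M N (a * b).
Proof.
by move=> Ma Nb; exists 1%N, (fun=> a), (fun=> b); rewrite big_ord1.
Qed.

Lemma mulmod0 M N : mulmod M N 0.
Proof.
by exists 0%N, (fun=> 0), (fun=> 0); rewrite big_ord0; split=> // -[].
Qed.

Lemma mulmodD M N x y :
  mulmod M N x -> mulmod M N y -> mulmod M N (x + y).
Proof.
move=> [m [a [b [Mab ->]]]] [n [c [d [Mcd ->]]]].
(* The two families of products are concatenated, [split] telling which one an index comes from. *)
exists (m + n)%N,
  (fun i => match split i with inl j => a j | inr j => c j end),
  (fun i => match split i with inl j => b j | inr j => d j end).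
split=> [i|]; first by case: (split i).
rewrite big_split_ord /=; congr (_ + _); apply: eq_bigr => i _.
  by rewrite (unsplitK (inl i : 'I_m + 'I_n)).
by rewrite (unsplitK (inr i : 'I_m + 'I_n)).
Qed.

Lemma mulmodC M N : mulmod M N = mulmod N M.
Proof.
apply/seteqP; split; apply: mulmod_min;
  by [apply: mulmod0|apply: mulmodD|
      move=> a b Ha Hb; rewrite mulrC; apply: mem_mulmod].
Qed.

Lemma mulmodSS M N M' N' :
  M `<=` M' -> N `<=` N' -> mulmod M N `<=` mulmod M' N'.
Proof.
move=> sM sN; apply: mulmod_min => [||a b /sM Ma /sN Nb];
  by [apply: mulmod0|apply: mulmodD|apply: mem_mulmod].
Qed.

Lemma sub_mulmod M N : N 1 -> M `<=` mulmod M N.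
Proof. by move=> N1 x Mx; rewrite -[x]mulr1; apply: mem_mulmod. Qed.

Lemma submodule_mulmod R M N : submodule R M -> submodule R (mulmod M N).
Proof.
case=> _ _ MZ; split; [exact: mulmod0|exact: mulmodD|move=> r x Rr].
move: x; apply: (@mulmod_min _ _ [set x | mulmod M N (r * x)]) => /=.
- by rewrite mulr0; apply: mulmod0.
- by move=> x y; rewrite mulrDr; apply: mulmodD.
- by move=> a b Ma Nb; rewrite mulrA; apply: mem_mulmod => //; apply: MZ.
Qed.

Lemma submodule_mulmodr R M N : submodule R N -> submodule R (mulmod M N).
Proof. by rewrite mulmodC; apply: submodule_mulmod. Qed.

(** This is what makes extension to an overring idempotent, and what bounds [E T(X)] from above. *)
Lemma mulmod_subl T M N : submodule T M -> N `<=` M -> mulmod N T `<=` M.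
Proof.
move=> [M0 MD MZ] sNM; apply: mulmod_min => // a b Na Tb.
by rewrite mulrC; apply: MZ => //; apply: sNM.
Qed.

Lemma dilate_mulmod x M N : mulmod (dilate x M) N = dilate x (mulmod M N).
Proof.
apply/seteqP; split.
  apply: mulmod_min => [|_ _ [u Mu <-] [v Mv <-]|_ b [a Ma <-] Nb].
  - by exists 0; [apply: mulmod0|rewrite mulr0].
  - by exists (u + v); [apply: mulmodD|rewrite mulrDr].
  - by exists (a * b); [apply: mem_mulmod|rewrite mulrA].
move=> _ [y My <-]; move: y My.
apply: (@mulmod_min _ _ [set y | mulmod (dilate x M) N (x * y)]) => /=.
- by rewrite mulr0; apply: mulmod0.
- by move=> u v; rewrite mulrDr; apply: mulmodD.
- by move=> a b Ma Nb; rewrite mulrA; apply: mem_mulmod => //; exists a.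
Qed.

Lemma FbarP R E : Fbar R E -> exists2 e, E e & e != 0.
Proof.
case=> -[E0 _ _] En0; apply: contrapT => nex; apply/En0/seteqP.
split=> [e Ee|_ ->//]; apply: contrapT => /eqP e0.
by apply: nex; exists e.
Qed.

Lemma FbarI R E e : submodule R E -> E e -> e != 0 -> Fbar R E.
Proof.
move=> modE Ee e0; split=> // E_0.
by move: Ee e0; rewrite E_0 => ->; rewrite eqxx.
Qed.

Lemma sub_wedge (I : Type) (T : I -> set L) E :
  (forall i, T i 1) -> E `<=` wedge T E.
Proof. by move=> T1 x Ex i _; apply: sub_mulmod. Qed.

Lemma wedge_Fbar R (I : Type) (T : I -> set L) E :
  (forall i, T i 1) -> Fbar R E -> Fbar R (wedge T E).
Proof.
move=> T1 FE; have [e Ee e0] := FbarP FE; apply: (FbarI _ _ e0).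
  by apply: submodule_bigcap => i _; apply: submodule_mulmod; case: FE.
exact: sub_wedge.
Qed.

(** The field is arbitrary, so that the lemma serves twice: in the quotient field of [D] for
    [wedge], and in the field of rational functions for the operations on [D[X]]. *)
Lemma semistar_wedge R (I : Type) (T : I -> set L) :
  (forall i, overring R (T i)) -> semistar R (wedge T).
Proof.
move=> overT.
have subT i : subring (T i) by apply/subringP; case: (overT i).
have T1 i : T i 1 by case: (subT i).
split=> [E FE|x E x0 _|E F _ _ sEF y Ey i _|E FE].
- exact: wedge_Fbar.
- apply/seteqP; split=> [y xy|_ [y Ey <-] i _].
    (* Dilation by a nonzero [x] is injective, so dividing by [x] works in all the members of the
       intersection at once. *)
    exists (x^-1 * y); last by rewrite mulVKf.
    move=> i /(xy i); rewrite dilate_mulmod => -[z Ez <-].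
    by rewrite mulKf.
  by rewrite dilate_mulmod; exists y => //; apply: Ey.
- exact: (mulmodSS sEF (@subset_refl _ (T i)) (Ey i Logic.I)).
- have sE F : F `<=` wedge T F by apply: sub_wedge.
  split=> //; apply/seteqP.
  split; first exact: sE.
  (* The closure of [E] lies in [mulmod E (T i)], which is already a [T i]-module. *)
  move=> x Ex i _; apply: mulmod_subl (Ex i Logic.I); last by move=> y; apply.
  by apply: submodule_mulmodr; case: (subT i).
Qed.

End Modules.

(** * Polynomials of unit content *)

Section Polynomials.
Variable K : fieldType.
Implicit Types (D M N E S T : set K) (f g h p q : {poly K}).

Lemma polyringE S p : polyring S (tofrac p) <-> forall i, S p`_i.
Proof.
split=> [[q Sq /eqP]|Sp]; last by exists p.
by rewrite tofrac_eq => /eqP <-.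
Qed.

Lemma submodule_coefM T M p q : submodule T M ->
  (forall i, T p`_i) -> (forall i, M q`_i) -> forall i, M (p * q)`_i.
Proof.
move=> modM Tp Mq i; rewrite coefM; apply: (submodule_sum _ modM) => j _.
by case: modM => _ _; apply.
Qed.

Lemma coefC_mem M c : M 0 -> M c -> forall i, M (c%:P)`_i.
Proof. by move=> M0 Mc i; rewrite coefC; case: ifP. Qed.

Lemma coefXn_mem T n : T 0 -> T 1 -> forall i, T ('X^n)`_i.
Proof. by move=> T0 T1 i; rewrite coefXn; case: eqP. Qed.

(** For [g] in [T[X]] this is the condition [c(g) = T], turned into an elimination rule: a content
    argument becomes the choice of a module [M]. *)
Definition primitive T g : Prop :=
  forall M, submodule T M -> (forall i, M g`_i) -> M 1.

Lemma primitiveP T g : subring T -> (forall i, T g`_i) ->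
  content T g = T <-> primitive T g.
Proof.
move=> [T1 _ modT] Tg; split=> [cT M modM Mg|primg].
  have: content T g 1 by rewrite cT.
  by apply: smallest_sub => // _ /(nthP 0)[i _ <-].
apply/seteqP; split.
  by apply: smallest_sub => // _ /(nthP 0)[i _ <-].
move=> t Tt M [modM sM]; have [M0 _ MZ] := modM.
rewrite -[t]mulr1; apply: MZ => //; apply: primg => // i.
(* [content] only sees the coefficients listed in [g]; those past its size are the default [0],
   which [M] contains. *)
have [lt_i|le_i] := ltnP i (size g); last by rewrite nth_default.
by apply/sM/mem_nth.
Qed.

(** Otherwise the zero module would contain all the coefficients, hence [1]. *)
Lemma primitive_neq0 T g : primitive T g -> g != 0.
Proof.
move=> primg; apply/eqP => g0.
have : [set (0 : K)] 1.
  apply: primg => [|i]; last by rewrite g0 coef0.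
  by split=> [//|_ _ -> ->|r _ _ ->] /=; rewrite ?addr0 ?mulr0.
by move/eqP; rewrite oner_eq0.
Qed.

Lemma primitive_coef1 T g i : g`_i = 1 -> primitive T g.
Proof. by move=> gi M _ Mg; rewrite -gi. Qed.

(* Replacing [f] by [g_j f - g_j f_n X^n] lowers the degree bound [n] and
   keeps the hypothesis, as soon as [g_j f_n] is in [M]; this is proved from
   the top coefficient of [g] downwards. *)
Lemma primitive_cancel T M f g : subring T -> submodule T M ->
    (forall i, T g`_i) -> primitive T g ->
  (forall i, M (f * g)`_i) -> forall i, M f`_i.
Proof.
move=> [_ TN1 _] modM Tg primg; have [M0 MD MZ] := modM.
have [n] : exists n, (size f <= n)%N by exists (size f).
elim: n f => [f f0 _ i|n IHn f le_fn Mfg].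
  by rewrite nth_default // (leq_trans f0).
suff Mgf j i : M (g`_j * f`_i).
  move=> i; rewrite -[f`_i]mul1r.
  (* The multipliers sending every coefficient of [f] into [M] form a [T]-module; once it contains
     the coefficients of [g], it contains [1]. *)
  apply: (primg [set t | forall i, M (t * f`_i)]) => //; split=> /=.
  - by move=> k; rewrite mul0r.
  - by move=> x y Mx My k; rewrite mulrDl; apply: MD.
  - by move=> r x Tr Mx k; rewrite -mulrA; apply: MZ.
have f_n0 k : (n < k)%N -> f`_k = 0.
  by move=> lt_nk; apply/nth_default/(leq_trans le_fn).
(* Descending induction on [j]: the coefficients of [g] vanish from [size g] on, and [IHm] covers
   the indices between [j] and [size g]. *)
have [m] := ubnP (size g - j); elim: m j i => // m IHm j i le_m.
have Mgj k l : (j < k)%N -> M (g`_k * f`_l).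
  have [le_gk _|lt_kg lt_jk] := leqP (size g) k.
    by rewrite nth_default // mul0r.
  apply/IHm/(leq_trans _ (ltnSE le_m)).
  by rewrite ltn_sub2l // (ltn_trans lt_jk).
have Mgjn : M (g`_j * f`_n).
  (* In degree [n + j], the terms with [k < n] involve a coefficient of [g] of index above [j], and
     those with [k > n] vanish, which isolates the term [k = n]. *)
  have := Mfg (n + j)%N; rewrite coefM.
  rewrite (bigD1 (inord n)) //= inordK ?ltnS ?leq_addr // addKn mulrC => Mc.
  rewrite -[_ * _](addrK (\sum_(k < (n + j).+1 | k != inord n)
                             f`_k * g`_(n + j - k))).
  apply: (submoduleB TN1 modM Mc).
  apply: (submodule_sum _ modM) => k k_n; rewrite mulrC.
  have [lt_kn|lt_nk|eq_kn] := ltngtP (k : nat) n; last 1 first.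
  - by move: k_n; rewrite -val_eqE /= inordK ?ltnS ?leq_addr // eq_kn eqxx.
  - by apply: Mgj; rewrite ltn_subRL ltn_add2r.
  - by rewrite f_n0 // mulr0.
pose f' := g`_j *: f - (g`_j * f`_n) *: 'X^n.
have f'E k : f'`_k = g`_j * f`_k - (g`_j * f`_n) * (k == n)%:R.
  by rewrite coefB !coefZ coefXn.
have Mf' : forall k, M f'`_k.
  apply: IHn => [|k].
    apply/leq_sizeP => k; rewrite leq_eqVlt f'E eq_sym.
    by case: eqP => [->|_ /f_n0 ->]; rewrite ?mulr1 ?subrr // !mulr0 subrr.
  (* Both parts of [f' * g] have coefficients in [M]: the first is a multiple of [f * g], the second
     a shift of [g] scaled by an element of [M]. *)
  rewrite mulrBl -!scalerAl coefB !coefZ.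
  apply: (submoduleB TN1 modM); first by apply: MZ.
  rewrite coefXnM; case: ifP => _; first by rewrite mulr0.
  by rewrite mulrC; apply: MZ.
have := Mf' i; rewrite f'E; have [->|_] := eqVneq i n; first by [].
by rewrite mulr0 subr0.
Qed.

(** A form of Gauss's lemma: cancelling [g] puts the coefficients of [f] in [M], and then [1]. *)
Lemma primitiveM T f g : subring T -> (forall i, T g`_i) ->
  primitive T f -> primitive T g -> primitive T (f * g).
Proof.
move=> subT Tg primf primg M modM Mfg.
exact: primf modM (primitive_cancel subT modM Tg primg Mfg).
Qed.

Lemma primitive1 T : primitive T 1.
Proof. by apply: (@primitive_coef1 _ _ 0%N); rewrite coef1. Qed.

(** * Modules of polynomials and Nagata rings *)

Lemma polyring_min S (P : set (ratfun K)) :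
    P 0 -> (forall x y, P x -> P y -> P (x + y)) ->
    (forall c n, S c -> P (cst c * tofrac 'X^n)) ->
  polyring S `<=` P.
Proof.
move=> P0 PD PX _ [p Sp <-]; rewrite -[p]coefK poly_def rmorph_sum.
by apply: big_ind => // i _; rewrite -mul_polyC rmorphM; apply: PX.
Qed.

Lemma polyringCXn M c n : M 0 -> M c -> polyring M (cst c * tofrac 'X^n).
Proof.
move=> M0 Mc; rewrite -rmorphM; apply/polyringE => i.
by rewrite coefCM coefXn; case: eqP => _; rewrite ?mulr1 ?mulr0.
Qed.

Lemma polyringD S x y : (forall a b, S a -> S b -> S (a + b)) ->
  polyring S x -> polyring S y -> polyring S (x + y).
Proof.
move=> SD [p Sp <-] [q Sq <-]; rewrite -rmorphD; apply/polyringE => i.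
by rewrite coefD; apply: SD.
Qed.

Lemma polyringS S S' : S `<=` S' -> polyring S `<=` polyring S'.
Proof. by move=> sS _ [p Sp <-]; apply/polyringE => i; apply: sS. Qed.

Lemma submodule_polyring T M :
  submodule T M -> submodule (polyring T) (polyring M).
Proof.
move=> modM; have [M0 MD _] := modM; split.
- by rewrite -(tofrac0 {poly K}); apply/polyringE => i; rewrite coef0.
- by move=> x y; apply: polyringD.
- move=> _ _ [p Tp <-] [q Mq <-]; rewrite -rmorphM.
  exact/polyringE/(submodule_coefM modM).
Qed.

Lemma subring_polyring T : subring T -> subring (polyring T).
Proof.
move=> [T1 TN1 modT]; have [T0 _ _] := modT.
split; last exact: submodule_polyring.
- by rewrite -(tofrac1 {poly K}); apply/polyringE; apply: coefC_mem.
- rewrite -(tofrac1 {poly K}) -rmorphN -polyCN.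
  by apply/polyringE; apply: coefC_mem.
Qed.

Lemma extendE D E : subring D -> submodule D E -> extend D E = polyring E.
Proof.
move=> [D1 _ [D0 _ _]] modE; have [E0 ED EZ] := modE.
apply/seteqP; split.
  apply: mulmod_min => [|x y|_ _ [e Ee <-] [p Dp <-]].
  - by case: (submodule_polyring modE).
  - exact: polyringD.
  - rewrite -rmorphM; apply/polyringE => i.
    by rewrite coefCM mulrC; apply: EZ.
apply: polyring_min => [||c n Ec]; [exact: mulmod0|exact: mulmodD|].
apply: mem_mulmod; first by exists c.
by apply/polyringE; apply: coefXn_mem.
Qed.

Lemma mulmod_polyring E T : E 0 -> T 0 ->
  mulmod (polyring E) (polyring T) = polyring (mulmod E T).
Proof.
move=> E0 T0; apply/seteqP; split.
  apply: mulmod_min => [|x y|_ _ [p Ep <-] [q Tq <-]].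
  - rewrite -(tofrac0 {poly K}); apply/polyringE => i.
    by rewrite coef0; apply: mulmod0.
  - by apply: polyringD => a b; apply: mulmodD.
  - rewrite -rmorphM; apply/polyringE => i; rewrite coefM.
    apply: big_ind => [||j _]; [exact: mulmod0|exact: mulmodD|].
    exact: mem_mulmod.
apply: polyring_min => [||c n]; [exact: mulmod0|exact: mulmodD|].
(* The condition is additive in [c], so [c] may be taken to be a product [a * b], with [a] put in
   the monomial and [b] left as a constant. *)
move: c; apply: (@mulmod_min _ _ _ [set c |
  mulmod (polyring E) (polyring T) (cst c * tofrac 'X^n)]) => /=.
- by rewrite /cst !rmorph0 mul0r; apply: mulmod0.
- by move=> x y; rewrite /cst !rmorphD mulrDl; apply: mulmodD.
- move=> a b Ea Tb; rewrite /cst !rmorphM mulrAC.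
  apply: mem_mulmod; first exact: polyringCXn.
  by apply/polyringE; apply: coefC_mem.
Qed.

(* For a [T]-module [M], this is the module [M T(X)]. *)
Definition nagata_mod T M : set (ratfun K) :=
  [set x | exists h g : {poly K},
     [/\ forall i, M h`_i, forall i, T g`_i, primitive T g
       & x = tofrac h / tofrac g]].

Lemma nagataE T : subring T -> nagata T = nagata_mod T T.
Proof.
move=> subT; apply/seteqP.
by split=> _ [f [g [Tf Tg /(primitiveP subT Tg) cg ->]]]; exists f, g.
Qed.

(** Sums are taken over the product of the denominators, which stays primitive by [primitiveM]. *)
Lemma submodule_nagata_mod T M :
  subring T -> submodule T M -> submodule (nagata T) (nagata_mod T M).
Proof.
move=> subT modM; have [T1 _ modT] := subT; have [M0 MD MZ] := modM.
have [T0 _ _] := modT; rewrite nagataE //; split.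
- exists 0, 1; split=> [i|||]; first by rewrite coef0.
  + exact: coefC_mem.
  + exact: primitive1.
  + by rewrite rmorph0 mul0r.
- move=> _ _ [h [g [Mh Tg primg ->]]] [k [f [Mk Tf primf ->]]].
  exists (h * f + k * g), (g * f); split.
  + move=> i; rewrite coefD.
    by apply: MD; rewrite mulrC; apply: (submodule_coefM modM).
  + exact: (submodule_coefM modT).
  + exact: primitiveM.
  + rewrite addf_div ?tofrac_eq0 ?(primitive_neq0 primg) //;
      last exact: primitive_neq0 primf.
    by rewrite tofracD !tofracM.
- move=> _ _ [p [f [Tp Tf primf ->]]] [h [g [Mh Tg primg ->]]].
  exists (p * h), (f * g); split.
  + exact: (submodule_coefM modM).
  + exact: (submodule_coefM modT).
  + exact: primitiveM.
  + by rewrite mulf_div !rmorphM.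
Qed.

Lemma sub_polyring_nagata_mod T M :
  subring T -> polyring M `<=` nagata_mod T M.
Proof.
move=> [T1 _ [T0 _ _]] _ [p Mp <-]; exists p, 1; split=> //.
- exact: coefC_mem.
- exact: primitive1.
- by rewrite rmorph1 divr1.
Qed.

(** Clearing the denominator gives [p * g = h], and [primitive_cancel] removes [g]. This is how
    Nagata rings are brought back to polynomials. *)
Lemma nagata_mod_poly T M p : subring T -> submodule T M ->
  nagata_mod T M (tofrac p) -> polyring M (tofrac p).
Proof.
move=> subT modM [h [g [Mh Tg primg hg]]].
apply/polyringE/(primitive_cancel subT modM Tg primg).
suff -> : p * g = h by [].
apply/eqP; rewrite -tofrac_eq rmorphM /= hg divfK //.
by rewrite tofrac_eq0 (primitive_neq0 primg).
Qed.

Lemma subring_nagata T : subring T -> subring (nagata T).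
Proof.
move=> subT; have [_ _ modT] := subT.
have [P1 PN1 _] := subring_polyring subT.
have sP := @sub_polyring_nagata_mod T T subT.
split; rewrite nagataE //; [exact: sP|exact: sP|].
by rewrite -{1}nagataE //; apply: submodule_nagata_mod.
Qed.

Lemma sub_polyring_nagata T : subring T -> polyring T `<=` nagata T.
Proof. by move=> subT; rewrite nagataE //; apply: sub_polyring_nagata_mod. Qed.

Lemma sub_mulmod_nagata T E : subring T ->
  mulmod (polyring E) (nagata T) `<=` nagata_mod T (mulmod E T).
Proof.
move=> subT; have [T1 _ modT] := subT; apply: mulmod_subl.
  by apply/submodule_nagata_mod/submodule_mulmodr.
apply: subset_trans (@sub_polyring_nagata_mod _ _ subT).
by apply: polyringS; apply: sub_mulmod.
Qed.

End Polynomials.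

(** * The three operations on [D[X]] and their values on [E[X]] *)

Section Wedges.
Variables (K : fieldType) (D : set K) (I : Type) (T : I -> set K).
Hypotheses (subD : subring D) (overT : forall i, overring D (T i)) (i0 : I).
Implicit Types (M E : set K) (p : {poly K}).

Lemma overring_subring i : subring (T i).
Proof. by apply/subringP; case: (overT i). Qed.

Let subT := overring_subring.

Lemma overring_polyring M :
  D `<=` M -> subring M -> overring (polyring D) (polyring M).
Proof.
by move=> sDM subM; split; [exact: polyringS|exact/subringP/subring_polyring].
Qed.

Lemma overring_nagata M :
  D `<=` M -> subring M -> overring (polyring D) (nagata M).
Proof.
move=> sDM subM; split; last exact/subringP/subring_nagata.
exact: subset_trans (polyringS sDM) (sub_polyring_nagata subM).
Qed.

Lemma semistar_square : semistar (polyring D) (wedge_square T).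
Proof.
apply: semistar_wedge => i; have [sDT _] := overT i.
exact: overring_polyring.
Qed.

Lemma semistar_paren : semistar (polyring D) (wedge_paren T).
Proof.
apply: semistar_wedge => i; have [sDT _] := overT i.
exact: overring_nagata.
Qed.

(** With [None] as the index of [K[X]], the angle operation falls under [semistar_wedge]. *)
Lemma wedge_angle_option : wedge_angle T =
  wedge (fun o => if o is Some i then nagata (T i) else polyring [set: K]).
Proof.
apply/funext => A; apply/seteqP; split=> [x [xT xK] [i|] _ //|x xA].
  exact: xT.
by split=> [i _|]; [apply: (xA (Some i))|apply: (xA None)].
Qed.

Lemma semistar_angle : semistar (polyring D) (wedge_angle T).
Proof.
rewrite wedge_angle_option; apply: semistar_wedge => -[i|].
  by have [sDT _] := overT i; apply: overring_nagata.
exact: overring_polyring.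
Qed.

Lemma wedge_square_polyring E :
  E 0 -> wedge_square T (polyring E) = polyring (wedge T E).
Proof.
move=> E0; have T0 i : T i 0 by have [_ _ []] := subT i.
apply/seteqP; split=> [x xE|_ [p Ep <-] i _].
  (* The index [i0] shows that [x] is a polynomial [p]; its coefficients are then tested at each
     [i]. *)
  have := xE i0 Logic.I; rewrite mulmod_polyring // => -[p _ px].
  exists p => // j i _; have := xE i Logic.I.
  by rewrite mulmod_polyring // -px => /polyringE; apply.
by rewrite mulmod_polyring //; apply/polyringE => j; apply: Ep.
Qed.

Lemma wedge_angle_polyring E :
  E 0 -> wedge_angle T (polyring E) = polyring (wedge T E).
Proof.
move=> E0; apply/seteqP; split=> [x [xT]|x].
  (* Here it is the factor [K[X]] that makes [x] a polynomial, as [nagata_mod_poly] requires. *)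
  rewrite mulmod_polyring // => -[p _ px]; exists p => // j i _.
  have [_ _ modT] := subT i; move: (xT i Logic.I).
  move=> /(sub_mulmod_nagata (subT i)); rewrite -px.
  by move=> /(nagata_mod_poly (subT i) (submodule_mulmodr _ modT))/polyringE.
rewrite -wedge_square_polyring // => xE.
split=> [i _|]; first exact: mulmodSS (sub_polyring_nagata (subT i)) _ (xE i _).
have sTK : polyring (T i0) `<=` polyring [set: K] by apply: polyringS.
exact: mulmodSS (@subset_refl _ _) sTK _ (xE i0 _).
Qed.

Lemma contract_polyring M : M 0 -> contract (polyring M) = M.
Proof.
move=> M0; apply/seteqP; split=> [c /polyringE/(_ 0%N)|c Mc].
  by rewrite coefC.
by apply/polyringE; apply: coefC_mem.
Qed.

(** A constant [c] equals [e * (e^-1 * c)], so it lies in [E K[X]]; on constants the paren and angle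
    closures of [E[X]] therefore agree. *)
Lemma contract_wedge_paren E e : E 0 -> E e -> e != 0 ->
  contract (wedge_paren T (polyring E)) = wedge T E.
Proof.
move=> E0 Ee e0; have wE0 : wedge T E 0 by move=> i _; apply: mulmod0.
rewrite -[RHS]contract_polyring // -wedge_angle_polyring //.
apply/seteqP; split=> c; last by case.
move=> cT; split=> //; rewrite mulmod_polyring //; apply/polyringE.
apply: coefC_mem; first exact: mulmod0.
by rewrite -(mulVKf e0 c); apply: mem_mulmod.
Qed.

End Wedges.

(** * Elements that tell the three operations apart *)

Section Separation.
Variable K : fieldType.
Implicit Types (D E S T : set K) (p : {poly K}).

Lemma invX_notin_polyring S : ~ polyring S (tofrac 'X)^-1.
Proof.
move=> [p _ pX]; suff /(congr1 (fun q : {poly K} => q`_0)) : p * 'X = 1.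
  by rewrite coefMX coef1 /= => /eqP; rewrite eq_sym oner_eq0.
apply/eqP; rewrite -tofrac_eq rmorphM /= pX mulVf ?rmorph1 //.
by rewrite tofrac_eq0 polyX_eq0.
Qed.

Lemma nagata_invX T : subring T -> nagata T (tofrac 'X)^-1.
Proof.
move=> subT; have [T1 _ [T0 _ _]] := subT; rewrite nagataE //.
exists 1, 'X; split.
- exact: coefC_mem.
- exact: (coefXn_mem 1).
- by apply: (@primitive_coef1 _ _ _ 1%N); rewrite coefX.
- by rewrite tofrac1 div1r.
Qed.

(* The ideal [(a, X)] of [D[X]]. *)
Definition idealX D (a : K) : set (ratfun K) :=
  [set tofrac p | p in
     [set p : {poly K} | (forall i, D p`_i) /\ exists2 d, D d & p`_0 = a * d]].

Lemma Fbar_idealX D a : subring D -> Fbar (polyring D) (idealX D a).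
Proof.
move=> subD; have [D1 _ modD] := subD; have [D0 DD DM] := modD.
apply: (@FbarI _ _ _ (tofrac 'X)); last by rewrite tofrac_eq0 polyX_eq0.
  split.
  - exists 0; last exact: tofrac0.
    by split=> [i|]; [rewrite coef0|exists 0; rewrite ?coef0 ?mulr0].
  - move=> _ _ [p [Dp [b Db pa]] <-] [q [Dq [c Dc qa]] <-].
    exists (p + q); last exact: tofracD.
    split=> [i|]; first by rewrite coefD; apply: DD.
    by exists (b + c); [apply: DD|rewrite coefD pa qa mulrDr].
  - move=> _ _ [r Dr <-] [p [Dp [b Db pa]] <-].
    exists (r * p); last exact: tofracM.
    split; first exact: submodule_coefM modD Dr Dp.
    by exists (r`_0 * b); [apply: DM|rewrite coef0M pa mulrCA].
exists 'X => //; split; first exact: (coefXn_mem 1).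
by exists 0; rewrite ?coefX ?mulr0.
Qed.

Lemma mem1_wedge_angle_idealX D (I : Type) (T : I -> set K) a :
    subring D -> (forall i, subring (T i)) -> D a -> a != 0 ->
  wedge_angle T (idealX D a) 1.
Proof.
move=> [D1 _ [D0 _ DM]] subT Da a0; split=> [i _|].
  rewrite -(@mulfV _ (tofrac 'X)) ?tofrac_eq0 ?polyX_eq0 //.
  apply: mem_mulmod (nagata_invX (subT i)); exists 'X => //.
  split; first exact: (coefXn_mem 1).
  by exists 0; rewrite ?coefX ?mulr0.
rewrite -(@tofrac1 {poly K}) -polyC1 -(mulfV a0) polyCM tofracM.
apply: mem_mulmod; last by apply/polyringE.
exists a%:P => //; split; first exact: coefC_mem.
by exists 1; rewrite ?coefC ?mulr1.
Qed.

(** The constant coefficient of any element of [(a, X) T[X]] lies in [aT]; for [1] this reads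
    [1 = a * t]. *)
Lemma mem1_mulmod_idealX D T a : D `<=` T -> subring T -> a != 0 ->
  mulmod (idealX D a) (polyring T) 1 -> T a^-1.
Proof.
move=> sDT [T1 _ modT] a0; have [T0 TD TM] := modT.
have sI : mulmod (idealX D a) (polyring T) `<=`
    [set tofrac p | p in [set p : {poly K} | exists2 t, T t & p`_0 = a * t]].
  apply: mulmod_min.
  - by exists 0; [exists 0; rewrite ?coef0 ?mulr0|exact: tofrac0].
  - move=> _ _ [p [b Tb pa] <-] [q [c Tc qa] <-].
    exists (p + q); last exact: tofracD.
    by exists (b + c); [apply: TD|rewrite coefD pa qa mulrDr].
  - move=> _ _ [p [_ [b Db pa]] <-] [q Tq <-].
    exists (p * q); last exact: tofracM.
    by exists (b * q`_0); [apply: TM => //; apply: sDT|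
                           rewrite coef0M pa mulrA].
move=> /sI[p [t Tt pa] /eqP]; rewrite -(tofrac1 {poly K}) tofrac_eq => /eqP p1.
suff -> : a^-1 = t by [].
by apply: (mulfI a0); rewrite mulfV // -pa p1 coef1.
Qed.

End Separation.

(** * The quotient field of [D] and the comparison of the operations *)

Lemma frac_quot (D : idomainType) (x : {fraction D}) :
  exists n d : D, d != 0 /\ x = tofrac n / tofrac d.
Proof.
elim/quotW: x => r; exists \n_r, \d_r; split; first exact: denom_ratioP.
apply: canRL (mulfK _) _; first by rewrite tofrac_eq0 denom_ratioP.
(* Multiplication is exposed on representatives, so that equality of classes becomes a
   cross-multiplied identity in [D]. *)
unlock tofrac; rewrite -[X in X = _]/(FracField.mul _ _) !piE.
apply/eqmodP; rewrite /= FracField.equivfE /FracField.mulf.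
rewrite !numden_Ratio ?mulf_neq0 ?oner_eq0 ?denom_ratioP //.
by rewrite !mulr1 mulrC.
Qed.

Lemma subring_range_frac (D : idomainType) : subring (range_frac D).
Proof.
split; [|exists (-1) => //; exact: tofracN|split].
- by exists 1 => //; apply: tofrac1.
- by exists 0 => //; apply: tofrac0.
- by move=> _ _ [x _ <-] [y _ <-]; exists (x + y) => //; apply: tofracD.
- by move=> _ _ [x _ <-] [y _ <-]; exists (x * y) => //; apply: tofracM.
Qed.

(** An overring containing the inverses of all nonzero elements of [D] contains every quotient
    [n / d]. *)
Lemma overring_proper_noninv (D : idomainType) (T : set {fraction D}) :
    overring (range_frac D) T -> T <> [set: {fraction D}] ->
  exists a, [/\ range_frac D a, a != 0 & ~ T a^-1].
Proof.
move=> overT TnK; apply: contrapT => nex; apply/TnK/seteqP; split=> // x _.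
have [sDT /subringP[_ _ [_ _ TM]]] := overT.
have [n [d [d0 ->]]] := frac_quot x; apply: TM; first by apply: sDT; exists n.
apply: contrapT => Td; apply: nex; exists (tofrac d).
by split; rewrite ?tofrac_eq0 //; exists d.
Qed.

Theorem corollary12 (D : idomainType) (I : Type) (T : I -> set {fraction D})
    (overT : forall i, overring (range_frac D) (T i))
    (T_nonempty : range T !=set0)
    (T_neqK : range T <> [set [set: {fraction D}]]) :
  let D0 := range_frac D in
  let DX := polyring D0 in
  let star := wedge T in
  let square := wedge_square T in
  let angle := wedge_angle T in
  let paren := wedge_paren T in
  ([/\ is_extension D0 star square,
       is_extension D0 star angle
     & is_extension D0 star paren] /\
   [/\ ~ same_semistar DX square angle,
       ~ same_semistar DX square paren
     & ~ same_semistar DX angle paren] /\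
   [/\ is_strict_extension D0 star square,
       is_strict_extension D0 star angle
     & ~ same_semistar DX square angle]) /\
  [/\ equiv_over D0 square angle /\ equiv_over D0 angle paren,
      strict_equiv_over D0 square angle,
      ~ strict_equiv_over D0 square paren
    & ~ strict_equiv_over D0 angle paren].
Proof.
move=> D0 DX star square angle paren.
have [i0 _] : exists i0 : I, True by have [_ [i _ _]] := T_nonempty; exists i.
have [i1 Ti1] : exists i, T i <> [set: {fraction D}].
  (* If every [T i] were the whole field, the range, being nonempty, would be exactly the excluded
     singleton. *)
  apply: contrapT => nex; apply/T_neqK/seteqP.
  have TK i : T i = setT by apply: contrapT => TnK; apply: nex; exists i.
  by split=> [_ [i _ <-]|_ ->]; [apply: TK|exists i0].
have subD : subring D0 := subring_range_frac D.
have subT := overring_subring overT.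
have T1 i : T i 1 by case: (subT i).
have [D1 _ modD] := subD.
have extE E : Fbar D0 E -> extend D0 E = polyring E.
  by case=> modE _; apply: extendE.
have squareE E : Fbar D0 E -> square (extend D0 E) = polyring (star E).
  by move=> FE; rewrite extE //; case: FE => -[E0 _ _] _;
     apply: wedge_square_polyring.
have angleE E : Fbar D0 E -> angle (extend D0 E) = polyring (star E).
  by move=> FE; rewrite extE //; case: FE => -[E0 _ _] _;
     apply: wedge_angle_polyring.
have star0 E : star E 0 by move=> i _; apply: mulmod0.
have parenE E : Fbar D0 E -> contract (paren (extend D0 E)) = star E.
  move=> FE; rewrite extE //; have [e Ee e0] := FbarP FE.
  by case: FE => -[E0 _ _] _; apply: contract_wedge_paren Ee e0.
have starF E : Fbar D0 E -> Fbar D0 (star E) by apply: wedge_Fbar.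
have semi_star : semistar D0 star by apply: semistar_wedge.
have semi_square : semistar DX square by apply: semistar_square.
have semi_angle : semistar DX angle by apply: semistar_angle.
have semi_paren : semistar DX paren by apply: semistar_paren.
have F_D : Fbar D0 D0 by apply: (FbarI modD D1); apply: oner_neq0.
have F_DX : Fbar DX DX.
  have [P1 _ modP] := subring_polyring subD.
  by apply: (FbarI modP P1); apply: oner_neq0.
have paren_invX : paren DX (tofrac 'X)^-1.
  move=> i _; rewrite -[_^-1]mul1r; apply: mem_mulmod (nagata_invX (subT i)).
  by case: (subring_polyring subD).
have DXE : extend D0 D0 = DX by apply: extE.
have square_paren : square DX <> paren DX.
  rewrite -DXE squareE // DXE => eq_sp.
  (* The square closure of [D[X]] consists of polynomials, whereas the paren one contains the
     inverse of [X]. *)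
  by apply: (@invX_notin_polyring _ (star D0)); rewrite eq_sp.
have angle_paren : angle DX <> paren DX.
  rewrite -DXE angleE // DXE => eq_sp.
  by apply: (@invX_notin_polyring _ (star D0)); rewrite eq_sp.
have [a [Da a0 Ta]] := overring_proper_noninv (overT i1) Ti1.
have square_angle : ~ same_semistar DX square angle.
  move=> /(_ _ (mem_set (Fbar_idealX a subD))) eq_sa; apply: Ta.
  have [sDT _] := overT i1.
  apply: (mem1_mulmod_idealX sDT (subT i1) a0).
  have : square (idealX D0 a) 1.
    by rewrite eq_sa; apply: mem1_wedge_angle_idealX.
  exact.
have square_neq : ~ same_semistar DX square paren.
  by move=> /(_ _ (mem_set F_DX)).
have angle_neq : ~ same_semistar DX angle paren.
  by move=> /(_ _ (mem_set F_DX)).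
have contract_star E : contract (polyring (star E)) = star E.
  exact: contract_polyring.
split; first split; [|split|].
- by split; split=> // E FE; rewrite ?squareE ?angleE ?parenE ?contract_star.
- by [].
- split=> //; split=> // E FE; rewrite ?squareE ?angleE // extE //;
  exact: starF.
split.
- by split=> E FE; rewrite ?squareE ?angleE ?parenE ?contract_star.
- by move=> E FE; rewrite squareE ?angleE.
(* At [E = D0], strict equivalence would be equality of the two closures of [DX], already
   refuted. *)
- by move=> /(_ _ F_D); rewrite DXE.
- by move=> /(_ _ F_D); rewrite DXE.
Qed.
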